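(* Every full-dimensional thick te-interlace is equivalent to exactly one of $$H_4=\begin{bmatrix}1&1&1&1\\1&-1&-1&1\\1&1&-1&-1\\1&-1&1&-1\end{bmatrix}\quad\text{and}\quad H_6=\begin{bmatrix}1&1&1&1&1&1\\1&-1&-1&1&1&1\\1&1&-1&-1&1&1\\1&1&1&-1&-1&1\\1&1&1&1&-1&-1\\1&-1&1&1&1&-1\end{bmatrix}.$$ In particular, no full-dimensional thick te-interlace has size at least $8$.
   Context: A full-dimensional thick te-interlace of size $n$ is an invertible matrix $H\in\{\pm1\}^{n\times n}$ such that $|\det H|=2^n$ and, for every $1\le k<n$, every nonzero $k\times k$ minor (determinant of a $k\times k$ submatrix) of $H$ has absolute value $2^{k-1}$. Two matrices are called equivalent if one can be obtained from the other by permuting rows and columns and by multiplying rows and columns by $-1$. *)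

(* Defs.v *)
From mathcomp Require Import all_boot all_order all_algebra all_fingroup.

Set Implicit Arguments.
Unset Strict Implicit.
Unset Printing Implicit Defensive.

Import GRing.Theory Num.Theory.
Local Open Scope ring_scope.

(* A k x k submatrix keeps k rows and k columns in their original order, so it
   is given by two strictly increasing selections of indices. *)
Definition increasing (k n : nat) (f : 'I_k -> 'I_n) : Prop :=
  {homo f : i j / (i < j)%N}.

(* Invertibility is over the rationals: over int, [unitmx] would only contain
   the matrices of determinant 1 or -1. *)
Definition full_thick_te_interlace (n : nat) (H : 'M[int]_n) : Prop :=
  [/\ forall i j, H i j = 1 \/ H i j = -1,
      map_mx (intr : int -> rat) H \in unitmx,
      `|\det H| = 2 ^+ n
    & forall (k : nat) (f g : 'I_k -> 'I_n),
        (1 <= k < n)%N -> increasing f -> increasing g ->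
        \det (mxsub f g H) != 0 ->
        `|\det (mxsub f g H)| = 2 ^+ k.-1].

(* The sizes of the two matrices need not be syntactically equal, hence the
   cast; the booleans a i and b j tell which rows and columns are negated. *)
Definition mx_equivalent (m n m' n' : nat)
    (A : 'M[int]_(m, n)) (B : 'M[int]_(m', n')) : Prop :=
  exists (em : m = m') (en : n = n') (s : 'S_m') (t : 'S_n')
         (a : 'I_m' -> bool) (b : 'I_n' -> bool),
    B = \matrix_(i, j)
          ((-1) ^+ a i * (-1) ^+ b j *
           row_perm s (col_perm t (castmx (em, en) A)) i j).

Definition mx_of_rows (n : nat) (rows : seq (seq int)) : 'M[int]_n :=
  \matrix_(i, j) (nth [::] rows i)`_j.

Definition H4 : 'M[int]_4 := mx_of_rows 4
  [:: [:: 1;  1;  1;  1];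
      [:: 1; -1; -1;  1];
      [:: 1;  1; -1; -1];
      [:: 1; -1;  1; -1]].

Definition H6 : 'M[int]_6 := mx_of_rows 6
  [:: [:: 1;  1;  1;  1;  1;  1];
      [:: 1; -1; -1;  1;  1;  1];
      [:: 1;  1; -1; -1;  1;  1];
      [:: 1;  1;  1; -1; -1;  1];
      [:: 1;  1;  1;  1; -1; -1];
      [:: 1; -1;  1;  1;  1; -1]].

(* Main.v *)
Require Import Defs.
From mathcomp Require Import all_boot all_order all_algebra all_fingroup.
From mathcomp Require Import zify ring.

(** Let H be such a matrix of size n >= 2. The minors of size n - 1 show that
    K = 4 H^-1 has entries 0, 1, -1; reducing modulo 2 shows that K has rank at
    most 1 there, hence no zero entry. The equations H K = K H = 4 then say that
    n >= 4 is even, that rows (and columns) pairwise differ in an even number of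
    places and that, once the first row and column are made positive, the sets
    X_a of negative positions of the rows are separated by the parities of the
    intersections |X_a & X_b|. Declare a and b adjacent when |X_a & X_b| is odd.
    If n > 4, four rows all of whose triples are "odd" would produce a 4 x 4
    Hadamard submatrix, of determinant 16 instead of 8. For the graph this says
    that it contains neither a triangle nor two independent edges; it has even
    degrees and no twins. A vertex of minimal positive degree then lies on an
    induced pentagon, and every vertex outside the pentagon is isolated or a
    twin of a vertex of the pentagon. Hence n = 6, and up to signs the five
    nonzero rows are the five edges of a pentagon, which is H_6. If n = 4, the
    nonzero rows are the three pairs of the last three columns, which is H_4. *)

Set Implicit Arguments.
Unset Strict Implicit.
Unset Printing Implicit Defensive.
Import Order.TTheory GRing.Theory Num.Theory.
Local Open Scope ring_scope.

(** * Minors and the inverse matrix *)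

(** The rank of [i], the number of smaller values of [f], is a permutation, and its inverse sorts
    [f]. *)
Lemma increasing_perm (k n : nat) (f : 'I_k -> 'I_n) :
  injective f -> exists s : 'S_k, increasing (f \o s).
Proof.
move=> f_inj; pose L i := [set i' | (f i' < f i)%N].
have L_lt i : (#|L i| < k)%N.
  rewrite -[X in (_ < X)%N]card_ord -cardsT; apply: proper_card.
  by rewrite properT; apply: contraTneq (in_setT i) => <-; rewrite inE ltnn.
have LS i j : (f i <= f j)%N -> (#|L i| <= #|L j|)%N.
  move=> le_ij; apply: subset_leq_card; apply/subsetP => x.
  by rewrite !inE => /leq_trans; apply.
have Llt i j : (f i < f j)%N -> (#|L i| < #|L j|)%N.
  move=> lt_ij; apply: proper_card; apply/properP; split; last first.
    by exists i; rewrite !inE ?ltnn.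
  by apply/subsetP => x; rewrite !inE => /ltn_trans; apply.
pose r i := Ordinal (L_lt i).
have r_inj : injective r.
  move=> i j /(congr1 val) /= eqL; apply: f_inj; apply: val_inj => /=.
  case: (ltngtP (f i) (f j)) => // /Llt; rewrite eqL ltnn //.
exists (perm r_inj)^-1%g => i j lt_ij /=; rewrite ltnNge; apply/negP => /LS.
have rK x : #|L ((perm r_inj)^-1%g x)| = x.
  by have := permKV (perm r_inj) x; rewrite permE => /(congr1 val).
by rewrite !rK leqNgt lt_ij.
Qed.

(** Reordering rows or columns only changes the sign of a minor, so later selections need not be
    sorted. *)
Lemma minor_injective (n : nat) (H : 'M[int]_n) (k : nat) (f g : 'I_k -> 'I_n) :
    full_thick_te_interlace H -> (0 < k < n)%N -> injective f -> injective g ->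
  \det (mxsub f g H) != 0 -> `|\det (mxsub f g H)| = 2 ^+ k.-1.
Proof.
case=> _ _ _ minors k_bd /increasing_perm[s incs] /increasing_perm[t inct].
have eq_abs : `|\det (mxsub (f \o s) (g \o t) H)| = `|\det (mxsub f g H)|.
  have ->: mxsub (f \o s) (g \o t) H = row_perm s (col_perm t (mxsub f g H)).
    by apply/matrixP => i j; rewrite !mxE.
  by rewrite row_permE col_permE !det_mulmx !det_perm !normrM !normrX !normrN1 !expr1n mul1r mulr1.
by rewrite -normr_eq0 -eq_abs normr_eq0; apply: minors.
Qed.

Definition sign_mx (m n : nat) (x : 'I_m -> 'I_n -> bool) : 'M[int]_(m, n) :=
  \matrix_(i, j) (-1) ^+ x i j.

Lemma norm_det_scale (n : nat) (r c : 'I_n -> bool) (A : 'M[int]_n) :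
  `|\det (\matrix_(i, j) ((-1) ^+ r i * (-1) ^+ c j * A i j))| = `|\det A|.
Proof.
have ->: \matrix_(i, j) ((-1) ^+ r i * (-1) ^+ c j * A i j) =
   diag_mx (\row_i (-1) ^+ r i) *m A *m diag_mx (\row_i (-1) ^+ c i).
  apply/matrixP => i j; rewrite mul_mx_diag mxE mul_diag_mx !mxE; ring.
rewrite !det_mulmx !det_diag !normrM !normr_prod.
have sgn1 (b : 'I_n -> bool) : \prod_i `|(\row_i (-1) ^+ b i) 0 i : int| = 1.
  by apply: big1 => i _; rewrite mxE normrX normrN1 expr1n.
by rewrite !sgn1 mul1r mulr1.
Qed.

Lemma cofactor_values (n : nat) (H : 'M[int]_n.+2) (i j : 'I_n.+2) :
    full_thick_te_interlace H ->
  [\/ cofactor H i j = 0, cofactor H i j = 2 ^+ n | cofactor H i j = - 2 ^+ n].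
Proof.
move=> te; rewrite /cofactor.
have [->|nz] := eqVneq (\det (row' i (col' j H))) 0; first by rewrite mulr0; constructor.
have Esub : row' i (col' j H) = mxsub (lift i) (lift j) H.
  by apply/matrixP => x y; rewrite !mxE.
rewrite Esub in nz *.
have := minor_injective te _ (@lift_inj _ i) (@lift_inj _ j) nz => /(_ _)/=.
rewrite ltnSn => /(_ isT) nrm.
have : `|(-1) ^+ (i + j) * \det (mxsub (lift i) (lift j) H)| = 2 ^+ n.
  by rewrite normrM normrX normrN1 expr1n mul1r.
have p0 : 0 <= (2 : int) ^+ n by rewrite exprn_ge0.
by move/eqP; rewrite eqr_norml p0 andbT => /orP[/eqP->|/eqP->]; constructor.
Qed.

(** The adjugate has entries 0 or ±2^n and the determinant is ±2^(n+2); their ratio leaves the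
    factor 4. *)
Lemma quarter_inverse (n : nat) (H : 'M[int]_n.+2) : full_thick_te_interlace H ->
  exists K : 'M[int]_n.+2,
    [/\ H *m K = 4%:M, K *m H = 4%:M &
        forall i j, [\/ K i j = 0, K i j = 1 | K i j = -1]].
Proof.
move=> te; case: (te) => _ _ detH _.
have p0 : 0 <= (2 : int) ^+ n.+2 by rewrite exprn_ge0.
have [e [e2 detE]] : exists e : int, (e = 1 \/ e = -1) /\ \det H = e * 2 ^+ n.+2.
  move/eqP: detH; rewrite eqr_norml p0 andbT => /orP[/eqP->|/eqP->].
    by exists 1; rewrite mul1r; split; [left|].
  by exists (-1); rewrite mulN1r; split; [right|].
have [K adjE Kv] : exists2 K : 'M[int]_n.+2, \adj H = (e * 2 ^+ n) *: K &
    forall i j, [\/ K i j = 0, K i j = 1 | K i j = -1].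
  (* The sign [e] of the determinant goes into [K], so that the products are 4 and not -4. *)
  exists (\matrix_(i, j) (e * sgz (\adj H i j))).
    apply/matrixP => i j; rewrite !mxE.
    case: (cofactor_values j i te) => ->; case: e2 => ->; rewrite ?sgzN ?sgz0 ?mulr0 //;
    by rewrite gtr0_sgz ?exprn_gt0 //; ring.
  move=> i j; rewrite !mxE; case: (cofactor_values j i te) => ->.
  - by rewrite sgz0 mulr0; constructor.
  - by rewrite gtr0_sgz ?exprn_gt0 // mulr1; case: e2 => ->; [constructor 2|constructor 3].
  - by rewrite sgzN gtr0_sgz ?exprn_gt0 // mulrN1; case: e2 => ->; rewrite ?opprK; [constructor 3|constructor 2].
have c0 : e * 2 ^+ n != 0 by rewrite mulf_neq0 ?expf_neq0 //; case: e2 => ->.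
have detE4 : \det H = e * 2 ^+ n * 4 by rewrite detE !exprS; ring.
have inj4 (A : 'M[int]_n.+2) : (e * 2 ^+ n) *: A = (\det H)%:M -> A = 4%:M.
  move=> eqA; apply/matrixP => i j; have /matrixP/(_ i j) := eqA.
  by rewrite !mxE detE4 -mulrnAr => /(mulfI c0).
exists K; split=> //; apply: inj4.
  by rewrite scalemxAr -adjE mul_mx_adj.
by rewrite scalemxAl -adjE mul_adj_mx.
Qed.

Lemma full_thick_te_interlace_scale (n : nat) (r c : 'I_n -> bool) (H : 'M[int]_n) :
    full_thick_te_interlace H ->
  full_thick_te_interlace (\matrix_(i, j) ((-1) ^+ r i * (-1) ^+ c j * H i j)).
Proof.
case=> entries unitH detH minors; split.
- move=> i j; rewrite !mxE -signr_addb; case: (_ (+) _); case: (entries i j) => ->;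
  by rewrite ?mulN1r ?mul1r ?opprK; auto.
- rewrite unitmxE det_map_mx unitfE intr_eq0 -normr_eq0 norm_det_scale detH.
  by rewrite expf_neq0.
- by rewrite norm_det_scale.
- move=> k f g k_bd incf incg.
  have ->: mxsub f g (\matrix_(i, j) ((-1) ^+ r i * (-1) ^+ c j * H i j)) =
    \matrix_(i, j) ((-1) ^+ (r \o f) i * (-1) ^+ (c \o g) j * (mxsub f g H) i j).
    by apply/matrixP => i j; rewrite !mxE.
  by rewrite -normr_eq0 norm_det_scale normr_eq0; apply: minors.
Qed.

Lemma normalize_interlace (n : nat) (H : 'M[int]_n.+1) : full_thick_te_interlace H ->
  exists (r c : 'I_n.+1 -> bool) (x : 'I_n.+1 -> 'I_n.+1 -> bool),
    [/\ forall i j, H i j = (-1) ^+ r i * (-1) ^+ c j * (-1) ^+ x i j,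
        forall j, x 0 j = false, forall i, x i 0 = false
      & full_thick_te_interlace (sign_mx x)].
Proof.
move=> te; case: (te) => entries _ _ _; pose y i j := H i j == -1.
have HE i j : H i j = (-1) ^+ y i j.
  by rewrite /y; case: (entries i j) => ->; rewrite ?eqxx.
(* The corner lies in both the first row and the first column, so [c] cancels it once. *)
pose r i := y i 0; pose c j := y 0 j (+) y 0 0.
exists r, c, (fun i j => r i (+) c j (+) y i j); split.
- by move=> i j; rewrite HE -!signr_addb addbA addbb.
- by move=> j; rewrite /r /c; case: (y 0 j); case: (y 0 0).
- by move=> i; rewrite /r /c; case: (y i 0); case: (y 0 0).
have := full_thick_te_interlace_scale r c te; congr full_thick_te_interlace.
by apply/matrixP => i j; rewrite !mxE HE -!signr_addb.
Qed.

(** Below corank 1 all cofactors vanish; at corank 1, [A *m \adj A = 0] confines the adjugate to a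
    kernel of dimension 1. *)
Lemma rank_adj_singular (F : fieldType) (n : nat) (A : 'M[F]_n) :
  \det A = 0 -> (\rank (\adj A) <= 1)%N.
Proof.
move=> detA; case: n => [|n] in A detA *; first by rewrite (leq_trans (rank_leq_row _)).
have [lt_rank|ge_rank] := ltnP (\rank A) n.
  suff ->: \adj A = 0 by rewrite mxrank0.
  apply/matrixP => i j; rewrite !mxE /cofactor; apply/eqP; rewrite mulf_eq0; apply/orP; right.
  apply: contraTT lt_rank; rewrite -leqNgt -unitfE -unitmxE => U.
  have {U} := mxrank_unit U.
  have ->: row' j (col' i A) = colsub (lift i) (rowsub (lift j) A).
    by apply/matrixP => x y; rewrite !mxE.
  move/esym/eq_leq => /= /leq_trans; apply.
  rewrite -mxrank_tr trmx_mxsub (leq_trans (mxrankS (rowsub_sub _ _))) // mxrank_tr.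
  by rewrite mxrankS ?rowsub_sub.
have A_adj : A *m \adj A = 0 by rewrite mul_mx_adj detA raddf0.
have := mulmx0_rank_max A_adj; lia.
Qed.

Lemma mx_rank1P (F : fieldType) (m n : nat) (A : 'M[F]_(m, n)) :
  (\rank A <= 1)%N -> exists (u : 'I_m -> F) (v : 'I_n -> F), forall i j, A i j = u i * v j.
Proof.
move=> rkA; rewrite -(mulmx_base A); move: (col_base A) (row_base A).
case: (\rank A) rkA => [|[|//]] _ B C.
  by exists (fun=> 0), (fun=> 0) => i j; rewrite mul0r mxE big_ord0.
by exists (fun i => B i 0), (fun j => C 0 j) => i j; rewrite mxE big_ord1.
Qed.

(* [K] is read off modulo 2 from the adjugate of the matrix [[1 | - x]] of
   determinant 2 or -2, which is singular modulo 2. *)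
Lemma quarter_inverse_odd (n : nat) (x : 'I_n.+2 -> 'I_n.+2 -> bool) (K : 'M[int]_n.+2) :
    (forall i, x i 0 = false) -> `|\det (sign_mx x)| = 2 ^+ n.+2 ->
    sign_mx x *m K = 4%:M -> K *m sign_mx x = 4%:M ->
    (forall i j, [\/ K i j = 0, K i j = 1 | K i j = -1]) ->
  forall i j, K i j = 1 \/ K i j = -1.
Proof.
move=> x0 detH HK KH Kv.
(* As (-1)^b = 1 - 2b, the sign matrix is [B *m U] with [U] upper triangular of determinant 2^(n+1),
   which leaves ±2 for [B]. [W] is half of [K *m B]. *)
pose B : 'M[int]_n.+2 := \matrix_(i, j) if j == 0 then 1 else - (x i j : nat)%:Z.
pose U : 'M[int]_n.+2 := \matrix_(i, j) if i == 0 then 1 else if i == j then 2 else 0.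
pose W : 'M[int]_n.+2 := \matrix_(i, j) if j == 0 then 2 * (i == 0 : nat)%:Z else (i == j : nat)%:Z - (i == 0 : nat)%:Z.
have HE : sign_mx x = B *m U.
  apply/matrixP => i j; rewrite !mxE (bigD1 0) //= !mxE eqxx mul1r.
  have [->|j0] := eqVneq j 0.
    rewrite big1 ?addr0 ?x0 // => k k0; rewrite !mxE (negPf k0) mulr0 //.
  rewrite (bigD1 j) //= big1 ?addr0; last first.
    by move=> k /andP[k0 kj]; rewrite !mxE (negPf k0) (negPf kj) mulr0.
  by rewrite !mxE (negPf j0) eqxx; case: (x i j); rewrite ?expr1 ?expr0.
have detU : \det U = 2 ^+ n.+1.
  rewrite -det_tr det_trig; last first.
    apply/is_trig_mxP => i j lt_ij; rewrite !mxE; case: eqP => [j0|_]; first by rewrite j0 in lt_ij.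
    by case: eqP => // ji; rewrite ji ltnn in lt_ij.
  rewrite big_ord_recl !mxE eqxx mul1r (eq_bigr (fun=> 2)) ?prodr_const ?card_ord //.
  by move=> i _; rewrite !mxE eqxx.
have detB : `|\det B| = 2.
  move: detH; rewrite HE detM normrM detU [`|2 ^+ _|]ger0_norm ?exprn_ge0 // [2 ^+ n.+2]exprS.
  by apply: mulIf; rewrite expf_neq0.
have KB : K *m B = 2 *: W.
  have KHE i j : \sum_k K i k * sign_mx x k j = 4 *+ (i == j).
    by have /matrixP/(_ i j) := KH; rewrite !mxE.
  have sumK i : \sum_k K i k = 4 *+ (i == 0).
    by rewrite -KHE; apply: eq_bigr => k _; rewrite mxE x0 mulr1.
  apply/matrixP => i j; rewrite !mxE; case: (eqVneq j 0) => [->|j0].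
    rewrite (eq_bigr (K i)) => [|k _]; last by rewrite mxE eqxx mulr1.
    by rewrite sumK; case: (i == 0).
  have: 2 * (\sum_k K i k * B k j) = 4 *+ (i == j) - 4 *+ (i == 0).
    rewrite -KHE -sumK mulr_sumr -sumrB; apply: eq_bigr => k _.
    rewrite !mxE (negPf j0); case: (x k j) => /=; rewrite ?expr1 ?expr0; ring.
  by case: (i == j); case: (i == 0); rewrite /= ?mulr1n ?mulr0n; lia.
(* Multiplying [K *m B = 2 *: W] by [\adj B] and cancelling 2 against the determinant ±2 of [B]
   gives an identity over the integers, which can be reduced modulo 2. *)
have [e e2 KE] : exists2 e : int, e = 1 \/ e = -1 & K = e *: (W *m \adj B).
  have KdB : \det B *: K = 2 *: (W *m \adj B).
    by rewrite scalemxAl -KB -mulmxA mul_mx_adj mul_mx_scalar.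
  have inj2 (X Y : 'M[int]_n.+2) : 2 *: X = 2 *: Y -> X = Y.
    by move=> /matrixP eqXY; apply/matrixP => i j; have := eqXY i j; rewrite !mxE; apply: mulfI.
  move/eqP: detB; rewrite eqr_norml andbT => /orP[]/eqP detB; rewrite detB in KdB.
    by exists 1; rewrite ?scale1r; [left|apply: inj2].
  exists (-1); [by right|apply: inj2; rewrite scaleN1r scalerN -KdB scaleNr opprK //].
pose f : int -> 'F_2 := intr.
have [u [v KF]] : exists (u v : 'I_n.+2 -> 'F_2), forall i j, f (K i j) = u i * v j.
  have rkK : (\rank (map_mx f K) <= 1)%N.
    rewrite KE map_mxZ map_mxM map_mx_adj (leq_trans (mxrank_scale _ _)) //.
    rewrite (leq_trans (mxrankM_maxr _ _)) // rank_adj_singular // det_map_mx.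
    by move/eqP: detB; rewrite eqr_norml andbT => /orP[]/eqP->; apply/eqP.
  by have [u [v KF]] := mx_rank1P rkK; exists u, v => i j; rewrite -KF mxE.
(* An even entry of [K] is 0, so a zero of [u] or [v] would make a whole row or column of [K]
   vanish. *)
have Kf0 i j : f (K i j) = 0 -> K i j = 0 by case: (Kv i j) => ->.
have u_nz i : u i != 0.
  apply/eqP => ui0; have /matrixP/(_ i i) := KH; rewrite !mxE eqxx big1 // => k _.
  by rewrite Kf0 ?mul0r // KF ui0 mul0r.
have v_nz j : v j != 0.
  apply/eqP => vj0; have /matrixP/(_ j j) := HK; rewrite !mxE eqxx big1 // => k _.
  by rewrite [K k j]Kf0 ?mulr0 // KF vj0 mulr0.
move=> i j; case: (Kv i j) => Kij; [|by left|by right].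
by have /eqP := KF i j; rewrite Kij eq_sym mulf_eq0 (negPf (u_nz i)) (negPf (v_nz j)).
Qed.

(** * Triangle-free graphs without two independent edges *)

Section TriangleFree.

Variables (T : finType) (e : rel T).
Hypothesis e_sym : symmetric e.
Hypothesis e_tri : forall a b c, e a b -> e b c -> e c a -> False.
Hypothesis e_2K2 : forall a b c d, e a b -> e c d -> [|| e a c, e a d, e b c | e b d].
Hypothesis e_twin : forall a b, e a =1 e b -> a = b.
Hypothesis e_deg : forall a b, e a b -> exists2 c, e a c & c != b.

(** Let [u] have minimal positive degree. Two neighbours of [u] are no twins, so some [x] is
    adjacent to one, [v1], and not to the other, [w1]. By minimality [x] has a neighbour [y] that is
    not adjacent to [u]; the edges [x y] and [u w1] can then only be joined by [y w1]. *)
Lemma induced_pentagon (a b : T) : e a b -> exists c0 c1 c2 c3 c4,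
  [/\ e c0 c1, e c1 c2, e c2 c3, e c3 c4 & e c4 c0].
Proof.
move=> eab; have Pa : [exists b, e a b] by apply/existsP; exists b.
case: (@arg_minnP _ a (fun u => [exists b, e u b]) (fun u => #|e u|) Pa) => u /existsP[v euv] u_min.
have [w euw wv] := e_deg euv.
have [v1 [w1 [x [euv1 euw1 ev1x ew1x]]]] :
    exists v w x, [/\ e u v, e u w, e v x & ~~ e w x].
  have /existsP[x] : [exists x, e v x != e w x].
    apply: contraNT wv => /existsPn eq_vw; apply/eqP/e_twin => x.
    by have /negPn/eqP := eq_vw x.
  case evx: (e v x); case ewx: (e w x) => // _.
    by exists v, w, x; rewrite ewx.
  by exists w, v, x; rewrite evx.
have Px : [exists y, e x y] by apply/existsP; exists v1; rewrite e_sym.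
have [y exy euy] : exists2 y, e x y & ~~ e u y.
  suff /subsetPn[y exy euy]: ~~ (e x \subset e u) by exact: (ex_intro2 _ _ y exy euy).
  apply: contraTN (u_min x Px) => sub_xu; rewrite -ltnNge; apply: proper_card.
  by apply/properP; split=> //; exists w1; rewrite // unfold_in e_sym.
exists u, v1, x, y, w1; split=> //; last by rewrite e_sym.
have /or4P[] // := e_2K2 exy euw1.
- by rewrite e_sym => eux; case: (e_tri euv1 ev1x); rewrite e_sym.
- by rewrite e_sym (negPf ew1x).
- by rewrite e_sym (negPf euy).
Qed.

(** A neighbour [t] of [y] missing from [d0] would, by the edge [d2 d3], be adjacent to [d2] or
    [d3]; that edge and the edge of [d0] opposite to it would be independent. *)
Lemma pentagon_twin (c0 c1 c2 c3 c4 z : T) :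
    e c0 c1 -> e c1 c2 -> e c2 c3 -> e c3 c4 -> e c4 c0 ->
  e z c1 -> e z c4 -> z = c0.
Proof.
have half d0 d1 d2 d3 d4 y : e d0 d1 -> e d1 d2 -> e d2 d3 -> e d3 d4 -> e d4 d0 ->
    e y d1 -> e y d4 -> forall t, e y t -> e d0 t.
  move=> e01 e12 e23 e34 e40 ey1 ey4 t eyt; apply: contraT => e0t.
  have ety : e t y by rewrite e_sym.
  have nt1 : e d1 t -> False by move=> e1t; apply: e_tri ey1 e1t ety.
  have nt4 : e d4 t -> False by move=> e4t; apply: e_tri ey4 e4t ety.
  have : e d2 t || e d3 t.
    have /or4P[e2y|e2t|e3y|->] := e_2K2 e23 eyt; rewrite ?e2t ?orbT //.
      by case: (e_tri ey1 e12 e2y).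
    by case: (e_tri ey4 _ (_ : e d3 y)) => //; rewrite e_sym.
  case/orP => [e2t|e3t].
    have /or4P[] := e_2K2 e2t e40.
    - by move=> e24; case: (e_tri e23 e34); rewrite e_sym.
    - by move=> e20; case: (e_tri e01 e12).
    - by rewrite e_sym => /nt4.
    - by rewrite e_sym (negPf e0t).
  have /or4P[] := e_2K2 e3t e01.
  - by rewrite e_sym => e03; case: (e_tri e34 e40).
  - by move=> e31; case: (e_tri e12 e23).
  - by rewrite e_sym (negPf e0t).
  - by rewrite e_sym => /nt1.
move=> e01 e12 e23 e34 e40 ez1 ez4; apply: e_twin => t; apply/idP/idP.
  exact: half e01 e12 e23 e34 e40 ez1 ez4 t.
(* [z] can replace [c0] in the pentagon, which exchanges their roles. *)
by apply: (half z c1 c2 c3 c4); rewrite // e_sym.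
Qed.

(** If [z] has a neighbour on the pentagon, it has another at distance two from it, so it equals the
    vertex between them. Otherwise the neighbours of [t] would be an independent set covering all
    edges of an odd cycle. *)
Lemma pentagon_complete (c0 c1 c2 c3 c4 z t : T) :
    e c0 c1 -> e c1 c2 -> e c2 c3 -> e c3 c4 -> e c4 c0 ->
  e z t -> z \in [:: c0; c1; c2; c3; c4].
Proof.
move=> e01 e12 e23 e34 e40 ezt.
(* An edge of the pentagon is joined to every edge, so the neighbours of [z]
   and of [t] in the pentagon cover all its edges. *)
have touch d0 d1 d2 d3 d4 : e d0 d1 -> e d1 d2 -> e d2 d3 -> e d3 d4 -> e d4 d0 ->
    e z d0 -> e z d2 \/ e z d3.
  move=> f01 f12 f23 f34 f40 ez0.
  have /or4P[] := e_2K2 ez0 f23; [by left|by right| |].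
    by move=> f02; case: (e_tri f01 f12); rewrite e_sym.
  by move=> f03; case: (e_tri f03 f34).
have two d0 d1 d2 d3 d4 : e d0 d1 -> e d1 d2 -> e d2 d3 -> e d3 d4 -> e d4 d0 ->
    e z d0 -> z = d1 \/ z = d4.
  move=> f01 f12 f23 f34 f40 ez0.
  have [ez2|ez3] := touch _ _ _ _ _ f01 f12 f23 f34 f40 ez0.
    by left; apply: (pentagon_twin f12 f23 f34 f40 f01).
  by right; apply: (pentagon_twin f40 f01 f12 f23 f34).
have [ez|/hasPn nz] := boolP (has (e z) [:: c0; c1; c2; c3; c4]).
  rewrite !inE; case/or4P: ez => [| | |/or3P[]//] ez.
  - by have [->|->] := two _ _ _ _ _ e01 e12 e23 e34 e40 ez; rewrite eqxx ?orbT.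
  - by have [->|->] := two _ _ _ _ _ e12 e23 e34 e40 e01 ez; rewrite eqxx ?orbT.
  - by have [->|->] := two _ _ _ _ _ e23 e34 e40 e01 e12 ez; rewrite eqxx ?orbT.
  - by have [->|->] := two _ _ _ _ _ e34 e40 e01 e12 e23 ez; rewrite eqxx ?orbT.
  - by have [->|->] := two _ _ _ _ _ e40 e01 e12 e23 e34 ez; rewrite eqxx ?orbT.
have nzc c : c \in [:: c0; c1; c2; c3; c4] -> e z c = false by move/nz/negPf.
have cover d d' : d \in [:: c0; c1; c2; c3; c4] -> d' \in [:: c0; c1; c2; c3; c4] ->
    e d d' -> e t d || e t d'.
  by move=> dP d'P /(e_2K2 ezt); rewrite !nzc.
have indep d d' : e d d' -> e t d -> e t d' -> False.
  by move=> edd' etd etd'; apply: e_tri etd edd' _; rewrite e_sym.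
have := cover c0 c1; have := cover c1 c2; have := cover c2 c3; have := cover c3 c4.
have := cover c4 c0; rewrite !inE !eqxx !orbT.
move=> /(_ isT isT e40) h40 /(_ isT isT e34) h34 /(_ isT isT e23) h23.
move=> /(_ isT isT e12) h12 /(_ isT isT e01) h01.
case t0: (e t c0) h40 h01 => h40 h01.
  have t1 : e t c1 = false by apply/negP => t1; apply: indep e01 t0 t1.
  have t4 : e t c4 = false by apply/negP => t4; apply: indep e40 t4 t0.
  by move: h12 h34; rewrite t1 t4 orbF => /(indep _ _ e23)/[apply].
rewrite orbF in h40; case/orP: h23 => [t2|t3].
  by case: (indep _ _ e12 h01 t2).
by case: (indep _ _ e34 t3 h40).
Qed.

(** A loop is a degenerate triangle, and identifying vertices at distance two closes a triangle. *)
Lemma pentagon_uniq (c0 c1 c2 c3 c4 : T) :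
    e c0 c1 -> e c1 c2 -> e c2 c3 -> e c3 c4 -> e c4 c0 ->
  uniq [:: c0; c1; c2; c3; c4].
Proof.
have adj a b : e a b -> a != b.
  by move=> eab; apply/eqP => ab; rewrite ab in eab; case: (e_tri eab eab).
have opp d0 d1 d2 d3 d4 : e d0 d1 -> e d1 d2 -> e d2 d3 -> e d3 d4 -> e d4 d0 -> d0 != d2.
  by move=> _ _ e23 e34 e40; apply/eqP => eq02; rewrite eq02 in e40; case: (e_tri e23 e34).
move=> e01 e12 e23 e34 e40.
have n02 := opp _ _ _ _ _ e01 e12 e23 e34 e40.
have n13 := opp _ _ _ _ _ e12 e23 e34 e40 e01.
have n24 := opp _ _ _ _ _ e23 e34 e40 e01 e12.
have n30 := opp _ _ _ _ _ e34 e40 e01 e12 e23.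
have n41 := opp _ _ _ _ _ e40 e01 e12 e23 e34.
rewrite eq_sym in n30; rewrite eq_sym in n41.
by rewrite /= !inE !negb_or n02 n13 n24 n30 n41 !adj // e_sym.
Qed.

End TriangleFree.

(** * Parities of a normalized interlace *)

Definition parity (n : nat) (P : 'I_n -> bool) : bool := \big[addb/false]_j P j.

Lemma parityD (n : nat) (P Q : 'I_n -> bool) :
  parity (fun j => P j (+) Q j) = parity P (+) parity Q.
Proof. exact: big_split. Qed.

Lemma parity_andl (n : nat) (b : bool) (P : 'I_n -> bool) :
  parity (fun j => b && P j) = b && parity P.
Proof. by case: b => //; rewrite /parity big1. Qed.

Lemma eq_parity (n : nat) (P Q : 'I_n -> bool) : P =1 Q -> parity P = parity Q.
Proof. by move=> PQ; apply: eq_bigr => j _. Qed.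

Lemma parity_exists (n : nat) (P : 'I_n -> bool) : parity P -> exists j, P j.
Proof.
move=> parP; apply/existsP; apply: contraLR parP => /existsPn nP.
by rewrite /parity big1 // => j _; apply/negbTE.
Qed.

Lemma even_exists_other (n : nat) (P : 'I_n -> bool) (d : 'I_n) :
  parity P = false -> P d -> exists2 d', P d' & d' != d.
Proof.
move=> parP Pd; have [j] : exists j, (j != d) && P j; last by case/andP; exists j.
apply: parity_exists; move: parP; rewrite /parity (bigD1 d) //= Pd big_mkcond /=.
by under eq_bigr => c _ do rewrite -[if _ then _ else _]/((c != d) && P c); case: (\big[_/_]_i _).
Qed.

Lemma parity_card (n : nat) (P : 'I_n -> bool) : parity P = odd #|P|.
Proof.
rewrite -sum1_card (big_morph odd oddD (erefl _)) /parity [RHS]big_mkcond.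
by apply: eq_bigr => j _; rewrite unfold_in; case: (P j).
Qed.

Lemma sum_signs_parity (n : nat) (k : 'I_n -> int) (P : 'I_n -> bool) :
    (forall j, k j = 1 \/ k j = -1) ->
  exists z, \sum_(j | P j) k j = 2 * z + (parity P : nat)%:Z.
Proof.
move=> k1; rewrite big_mkcond /parity.
elim/big_rec2: _ => [|j b s _ [z ->]] /=; first by exists 0.
case: (P j); last by exists z; rewrite /= add0r.
by case: (k1 j) => ->; case: b => /=; [exists (z + 1)|exists z|exists z|exists (z - 1)];
  rewrite /=; ring.
Qed.

Lemma signr_eq (b : bool) : (-1 : int) ^+ b = 1 \/ (-1 : int) ^+ b = -1.
Proof. by case: b; [right|left]. Qed.

Section QuarterInverse.

Variables (n : nat) (x : 'I_n -> 'I_n -> bool) (K : 'M[int]_n).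
Hypothesis K1 : forall i j, K i j = 1 \/ K i j = -1.
Hypothesis HK : sign_mx x *m K = 4%:M.

Let S1 a j : (-1) ^+ x a j * K j a = 1 \/ (-1) ^+ x a j * K j a = -1.
Proof. by case: (signr_eq (x a j)) => ->; case: (K1 j a) => ->; [left|right|right|left]. Qed.

Let sumS a b : \sum_j (-1) ^+ x a j * K j b = 4 *+ (a == b).
Proof. by have /matrixP/(_ a b) := HK; rewrite !mxE => <-; apply: eq_bigr => j _; rewrite mxE. Qed.

Lemma parity_size : (0 < n)%N -> parity (fun _ : 'I_n => true) = false.
Proof.
move=> n_gt0; have [z] := sum_signs_parity (fun _ => true) (S1 (Ordinal n_gt0)).
rewrite sumS eqxx; case: parity => //=; lia.
Qed.

Lemma four_le_size : (0 < n)%N -> (4 <= n)%N.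
Proof.
move=> n_gt0.
have := sumS (Ordinal n_gt0) (Ordinal n_gt0); rewrite eqxx mulr1n => sum4.
have : \sum_j (-1) ^+ x (Ordinal n_gt0) j * K j (Ordinal n_gt0) <= \sum_(j < n) (1 : int).
  by apply: ler_sum => j _; case: (S1 (Ordinal n_gt0) j) => ->.
by rewrite sum4 sumr_const card_ord natz; lia.
Qed.

(** In the difference of the equations for rows [a] and [b], equal entries cancel and the others
    double: the signs at differing positions sum to 2, so their number is even. *)
Lemma parity_distance a b : parity (fun j => x a j (+) x b j) = false.
Proof.
have [->|neq_ab] := eqVneq a b.
  by rewrite /parity big1 // => j _; rewrite addbb.
have [z] := sum_signs_parity (fun j => x a j (+) x b j) (S1 a).
suff : 2 * \sum_(j | x a j (+) x b j) (-1) ^+ x a j * K j a = 4.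
  by move=> sum4 sumE; rewrite sumE in sum4; case: parity sum4 => //=; lia.
have <- : \sum_j (-1) ^+ x a j * K j a - \sum_j (-1) ^+ x b j * K j a = 4.
  by rewrite !sumS eqxx eq_sym (negPf neq_ab) subr0.
rewrite -sumrB mulr_sumr big_mkcond; apply: eq_bigr => j _.
by case: (x a j); case: (x b j) => /=; rewrite ?expr1 ?expr0; ring.
Qed.

Lemma rows_injective a b : x a =1 x b -> a = b.
Proof.
move=> eq_ab; have := sumS a a; under eq_bigr => j _ do rewrite eq_ab.
by rewrite sumS eqxx eq_sym; case: eqP.
Qed.

End QuarterInverse.

(** Row [a] sums over [Z] to |Z| - 2|Z & X_a| = 2z - 4w_a. Applying [K], whose row sums vanish
    except in row 0, gives Z_j = 2z[j = 0] - (K w)_j, and the parity of (K w)_j is the same for all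
    [j] because [K] has odd entries. *)
Lemma even_meet_constant (n : nat) (x : 'I_n.+1 -> 'I_n.+1 -> bool) (K : 'M[int]_n.+1)
    (Z : 'I_n.+1 -> bool) :
    (forall i j, K i j = 1 \/ K i j = -1) -> K *m sign_mx x = 4%:M ->
    (forall i, x i 0 = false) -> parity Z = false ->
    (forall a, parity (fun j => Z j && x a j) = false) ->
  forall j k, Z j = Z k.
Proof.
move=> K1 KH x0 parZ parZx.
have KHE j k : \sum_a K j a * (-1) ^+ x a k = 4 *+ (j == k).
  by have /matrixP/(_ j k) := KH; rewrite !mxE => <-; apply: eq_bigr => a _; rewrite mxE.
have [z sumZ] : exists z, \sum_(j | Z j) (1 : int) = 2 * z.
  have [z ->] := sum_signs_parity Z (fun j => or_introl (erefl (1 : int)) : 1 = 1 \/ 1 = -1).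
  by exists z; rewrite parZ addr0.
have [w wE] : exists w : 'I_n.+1 -> int, forall a, \sum_(j | Z j) (-1) ^+ x a j = 2 * z - 4 * w a.
  apply: (@fin_all_exists _ (fun=> int) (fun a w => \sum_(j | Z j) (-1) ^+ x a j = 2 * z - 4 * w)) => a.
  have [w wE] := sum_signs_parity (fun j => Z j && x a j)
    (fun j => or_introl (erefl (1 : int)) : 1 = 1 \/ 1 = -1).
  exists w; rewrite parZx addr0 big_mkcondr in wE.
  have -> : 4 * w = 2 * (2 * w) by ring.
  rewrite -wE -sumZ mulr_sumr -sumrB; apply: eq_bigr => j _; case: (x a j) => //.
have ZE j : 4 * (Z j : nat)%:Z = 2 * z * (4 *+ (j == 0)) - 4 * \sum_a K j a * w a.
  have -> : 4 * (Z j : nat)%:Z = \sum_(k | Z k) \sum_a K j a * (-1) ^+ x a k.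
    under eq_bigr => k _ do rewrite KHE.
    rewrite big_mkcond (bigD1 j) //= eqxx big1 ?addr0; first by case: (Z j).
    by move=> k; rewrite eq_sym => /negPf->; case: (Z k).
  rewrite -KHE exchange_big /= !mulr_sumr -sumrB; apply: eq_bigr => a _.
  by rewrite -mulr_sumr wE x0 expr0; ring.
move=> j k; have [d dE] : exists d, \sum_a K j a * w a - \sum_a K k a * w a = 2 * d.
  exists (\sum_a (if K j a == K k a then 0 else K j a) * w a).
  rewrite mulr_sumr -sumrB; apply: eq_bigr => a _.
  by case: (K1 j a) => ->; case: (K1 k a) => -> /=; ring.
have := ZE j; have := ZE k; move: dE.
move: (\sum_a K j a * w a) (\sum_a K k a * w a) => s t.
case: (j == 0); case: (k == 0); case: (Z j); case: (Z k); rewrite /= ?mulr1n ?mulr0n; lia.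
Qed.

(** A repeated row would put the diagonal value [k] off the diagonal. *)
Lemma mxsub_injective (n k : nat) (A : 'M[int]_n) (f g : 'I_k -> 'I_n) :
  mxsub f g A *m (mxsub f g A)^T = k%:R%:M -> injective f.
Proof.
move=> SST i i' eqf; have /matrixP eqS := SST.
apply/eqP; apply: contraT => /negPf neq_ii'.
have := eqS i i; have := eqS i i'; rewrite !mxE eqxx neq_ii' mulr0n mulr1n.
under eq_bigr => j _ do rewrite !mxE -eqf.
under [in X in _ -> X]eq_bigr => j _ do rewrite !mxE.
by move=> ->; case: k i {i' eqf neq_ii' SST eqS f g} => [[]|k] // _ /eqP; rewrite eq_sym pnatr_eq0.
Qed.

(* Four rows and four columns with pairwise orthogonal entries would span a
   minor of absolute value 16, not 8. *)
Lemma no_hadamard (n : nat) (A : 'M[int]_n) (f g : 'I_4 -> 'I_n) :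
    (4 < n)%N -> full_thick_te_interlace A ->
    mxsub f g A *m (mxsub f g A)^T = 4%:M ->
  (mxsub f g A)^T *m mxsub f g A = 4%:M -> False.
Proof.
move=> n_gt4 te SST STS.
have f_inj := mxsub_injective SST.
have g_inj : injective g.
  by apply: (@mxsub_injective _ _ A^T g f); rewrite -trmx_mxsub trmxK.
have det2 : \det (mxsub f g A) ^+ 2 = 256.
  by have := congr1 determinant SST; rewrite det_mulmx det_tr det_scalar -expr2.
have := minor_injective te _ f_inj g_inj; rewrite n_gt4 => /(_ isT).
have nz : \det (mxsub f g A) != 0 by apply/eqP => d0; rewrite d0 in det2.
by move/(_ nz) => abs_det; have := congr1 Num.norm det2; rewrite normrX abs_det.
Qed.

Section OddTriples.

Variables (n : nat) (x : 'I_n -> 'I_n -> bool).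
Hypothesis n_gt4 : (4 < n)%N.
Hypothesis te : full_thick_te_interlace (sign_mx x).
Hypothesis parity_n : parity (fun _ : 'I_n => true) = false.
Hypothesis parity_x : forall a, parity (x a) = false.

Definition meet_parity (a b : 'I_n) : bool := parity (fun j => x a j && x b j).

(** For rows of even weight, this is the parity of the number of columns where [b] and [c] both
    differ from [a]. *)
Definition odd_triple (a b c : 'I_n) : bool :=
  meet_parity a b (+) meet_parity b c (+) meet_parity a c.

(** The number of such columns is odd: in the expansion of their indicator modulo 2, all terms
    outside [odd_triple] are parities of single rows or of the size. *)
Lemma odd_triple_pattern (a b c : 'I_n) (p q : bool) : odd_triple a b c ->
  exists2 j, x b j = x a j (+) p & x c j = x a j (+) q.
Proof.
move=> odd_abc.
have [j] : exists j, (x a j (+) x b j (+) ~~ p) && (x a j (+) x c j (+) ~~ q).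
  apply: parity_exists.
  rewrite (@eq_parity _ _ (fun j => (((x a j && x b j) (+) (x b j && x c j)
     (+) (x a j && x c j)) (+) (x a j (+) (~~ q && (x a j (+) x b j))))
     (+) ((~~ p && (x a j (+) x c j)) (+) (~~ p && ~~ q && true)))); last first.
    by move=> j; case: (x a j); case: (x b j); case: (x c j); case: p; case: q.
  rewrite !(parityD, parity_andl) !parity_x parity_n !andbF !addbF.
  exact: odd_abc.
move=> /andP[pj qj]; exists j; move: pj qj;
by case: (x a j); case: (x b j); case: (x c j); case: p; case: q.
Qed.

Lemma odd_quadruple_free (a b c d : 'I_n) :
  odd_triple a b c -> odd_triple a b d -> odd_triple a c d -> odd_triple b c d -> False.
Proof.
move=> abc abd acd bcd.
pose I p q r := [exists j, [&& x b j == x a j (+) p, x c j == x a j (+) q & x d j == x a j (+) r]].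
(* Each odd triple shows every pattern on its three rows; if [p q r] is missing, the fourth row must
   take the other value there. For [b c d], read relative to [b], this flips all three. *)
have I_next p q r : ~~ I p q r ->
    [/\ I p q (~~ r), I p (~~ q) r, I (~~ p) q r & I (~~ p) (~~ q) (~~ r)].
  move=> /existsPn nI; split; apply/existsP.
  - have [j bj cj] := odd_triple_pattern p q abc; exists j; have := nI j.
    by rewrite bj cj; case: (x a j); case: (x d j); case: p {bj nI}; case: q {cj}; case: r.
  - have [j bj cj] := odd_triple_pattern p r abd; exists j; have := nI j.
    by rewrite bj cj; case: (x a j); case: (x c j); case: p {bj nI}; case: q; case: r {cj}.
  - have [j bj cj] := odd_triple_pattern q r acd; exists j; have := nI j.
    by rewrite bj cj; case: (x a j); case: (x b j); case: p {nI}; case: q {bj}; case: r {cj}.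
  - have [j bj cj] := odd_triple_pattern (p (+) q) (p (+) r) bcd; exists j; have := nI j.
    rewrite bj cj; case: (x a j) => /=; case: (x b j) {bj cj}; case: p {nI} => /=; case: q; case: r => //.
(* The eight column types split into two classes of four pairwise orthogonal
   types, and a missing type forces the presence of the whole other class. *)
have [o Io] : exists o, [/\ I o o o, I (~~ o) (~~ o) o, I (~~ o) o (~~ o) & I o (~~ o) (~~ o)].
  case I1: (I false false false); last first.
    by exists true; have [] := I_next _ _ _ (negbT I1).
  case I2: (I true true false); last first.
    by exists true; have [] := I_next _ _ _ (negbT I2).
  case I3: (I true false true); last first.
    by exists true; have [] := I_next _ _ _ (negbT I3).
  case I4: (I false true true); last first.
    by exists true; have [] := I_next _ _ _ (negbT I4).
  by exists false.
case: Io => /existsP[j1 /and3P[/eqP b1 /eqP c1 /eqP d1]].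
move=> /existsP[j2 /and3P[/eqP b2 /eqP c2 /eqP d2]].
move=> /existsP[j3 /and3P[/eqP b3 /eqP c3 /eqP d3]].
move=> /existsP[j4 /and3P[/eqP b4 /eqP c4 /eqP d4]].
pose f (i : 'I_4) := tnth [tuple a; b; c; d] i.
pose g (i : 'I_4) := tnth [tuple j1; j2; j3; j4] i.
apply: (@no_hadamard _ _ f g n_gt4 te); apply/matrixP => i k.
  rewrite !mxE !big_ord_recl big_ord0 !mxE /f /g.
  case: i => [[|[|[|[|//]]]] iP]; case: k => [[|[|[|[|//]]]] kP];
  rewrite !(tnth_nth a) /= ?b1 ?b2 ?b3 ?b4 ?c1 ?c2 ?c3 ?c4 ?d1 ?d2 ?d3 ?d4;
  by move: (x a j1) (x a j2) (x a j3) (x a j4) (o); clear; do 5!case.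
rewrite !mxE !big_ord_recl big_ord0 !mxE /f /g.
case: i => [[|[|[|[|//]]]] iP]; case: k => [[|[|[|[|//]]]] kP];
rewrite !(tnth_nth a) /= ?b1 ?b2 ?b3 ?b4 ?c1 ?c2 ?c3 ?c4 ?d1 ?d2 ?d3 ?d4;
by move: (x a j1) (x a j2) (x a j3) (x a j4) (o); clear; do 5!case.
Qed.

End OddTriples.

(** What the classification uses besides the normalization and the exclusion of Hadamard minors. *)
Record even_sign_pattern (n : nat) (x : 'I_n.+1 -> 'I_n.+1 -> bool) : Prop := {
  four_le : (4 <= n.+1)%N;
  parity_all : parity (fun _ : 'I_n.+1 => true) = false;
  parity_row : forall a, parity (x a) = false;
  parity_col : forall j, parity (x^~ j) = false;
  rows_inj : forall a b, x a =1 x b -> a = b;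
  meet_parity_inj : forall a b, meet_parity x a =1 meet_parity x b -> a = b }.

Lemma normalized_even (n : nat) (x : 'I_n.+1 -> 'I_n.+1 -> bool) :
    full_thick_te_interlace (sign_mx x) ->
    (forall j, x 0 j = false) -> (forall i, x i 0 = false) ->
  even_sign_pattern x.
Proof.
case: n x => [|n] x te x0j xi0.
  (* In size 1 the determinant is 1 instead of ±2. *)
  case: te => _ _ + _; rewrite [\det _](_ : _ = 1) ?normr1 //.
  by rewrite [sign_mx x]mx11_scalar det_scalar1 mxE x0j.
have [K [HK KH Kv]] := quarter_inverse te.
have detx : `|\det (sign_mx x)| = 2 ^+ n.+2 by case: te.
have K1 := quarter_inverse_odd xi0 detx HK KH Kv.
have par_row a : parity (x a) = false.
  rewrite -(parity_distance K1 HK 0 a); apply: eq_parity => j.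
  by rewrite x0j.
have inj_row := rows_injective HK.
split=> //.
- exact: (four_le_size K1 HK isT).
- exact: (parity_size K1 HK isT).
- move=> j.
  (* The columns are the rows of the transpose, with [K^T] in place of [K]. *)
  have trE (y : 'I_n.+2 -> 'I_n.+2 -> bool) : (sign_mx y)^T = sign_mx (fun i k => y k i).
    by apply/matrixP => i k; rewrite !mxE.
  have HK' : sign_mx (fun i k => x k i) *m K^T = 4%:M.
    by rewrite -trE -trmx_mul KH tr_scalar_mx.
  have K1' i k : K^T i k = 1 \/ K^T i k = -1 by rewrite mxE.
  rewrite -(parity_distance K1' HK' 0 j); apply: eq_parity => i.
  by rewrite xi0.
move=> a b eq_ab; apply: inj_row => j.
(* The symmetric difference of the two rows meets every row evenly, so it is constant, and it misses
   column 0. *)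
have Z0 := @even_meet_constant _ x K (fun j => x a j (+) x b j) K1 KH xi0.
suff: x a j (+) x b j = false by case: (x a j); case: (x b j).
rewrite (Z0 _ _ j 0) ?xi0 //; first by rewrite parityD !par_row.
move=> c; rewrite -[RHS](addbb (meet_parity x a c)) [X in _ (+) X]eq_ab -parityD.
by apply: eq_parity => k; rewrite -andb_addl.
Qed.

Lemma interlace_pentagon (n : nat) (x : 'I_n.+1 -> 'I_n.+1 -> bool) :
    (4 < n.+1)%N -> full_thick_te_interlace (sign_mx x) -> even_sign_pattern x ->
    (forall j, x 0 j = false) ->
  exists c0 c1 c2 c3 c4, let e := meet_parity x in
    [/\ uniq [:: 0; c0; c1; c2; c3; c4], forall z, z \in [:: 0; c0; c1; c2; c3; c4],
        [&& e c0 c1, e c1 c2, e c2 c3, e c3 c4 & e c4 c0] &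
        [&& ~~ e c0 c2, ~~ e c1 c3, ~~ e c2 c4, ~~ e c3 c0 & ~~ e c4 c1]].
Proof.
move=> n_gt4 te ev x0j; pose e := meet_parity x.
have quad := odd_quadruple_free n_gt4 te (parity_all ev) (parity_row ev).
have e_sym : symmetric e.
  by move=> a b; apply: eq_parity => j; rewrite andbC.
have e0 b : e 0 b = false by rewrite /e /meet_parity /parity big1 // => j _; rewrite x0j.
(* A triangle together with the isolated vertex 0 has only odd triples. *)
have e_tri a b c : e a b -> e b c -> e c a -> False.
  move=> eab ebc eca; apply: (quad 0 a b c);
  by rewrite /odd_triple -/e ?e0 ?eab ?ebc ?[e a c]e_sym ?eca.
(* Each triple of the four vertices contains exactly one of the two independent edges. *)
have e_2K2 a b c d : e a b -> e c d -> [|| e a c, e a d, e b c | e b d].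
  move=> eab ecd; apply: contraT; rewrite !negb_or => /and4P[/negPf ac /negPf ad /negPf bc /negPf bd].
  by case: (quad a b c d); rewrite /odd_triple -/e ?eab ?ecd ?ac ?ad ?bc ?bd.
have e_twin : forall a b, e a =1 e b -> a = b by move=> a b; apply: meet_parity_inj.
(* Degrees are even: summing over the second row first gives column parities. *)
have e_deg a b : e a b -> exists2 c, e a c & c != b.
  apply: even_exists_other; rewrite /parity exchange_big /= big1 // => j _.
  have -> : \big[addb/false]_i (x a j && x i j) = parity (fun i => x a j && x i j) by [].
  by rewrite parity_andl (parity_col ev) andbF.
(* Another vertex without neighbours would be a twin of 0. *)
have [b eab] : exists b, e ord_max b.
  apply/existsP; apply: contraLR n_gt4 => /existsPn no_nbr.
  have /(congr1 val) /= -> // : ord_max = 0 :> 'I_n.+1.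
  by apply: e_twin => b; rewrite e0; apply/negbTE/no_nbr.
have [c0 [c1 [c2 [c3 [c4 [e01 e12 e23 e34 e40]]]]]] := induced_pentagon e_sym e_tri e_2K2 e_twin e_deg eab.
have chord u v w : e u v -> e v w -> ~~ e u w.
  by move=> euv evw; apply/negP; rewrite e_sym; apply: e_tri evw.
exists c0, c1, c2, c3, c4; split.
- rewrite cons_uniq (pentagon_uniq e_sym e_tri e01 e12 e23 e34 e40) andbT.
  have nz c t : e c t -> (0 == c) = false by move=> ect; apply/eqP => z; rewrite -z e0 in ect.
  by rewrite !inE (nz _ _ e01) (nz _ _ e12) (nz _ _ e23) (nz _ _ e34) (nz _ _ e40).
- move=> z; rewrite inE; have [//|/= z_nz] := eqVneq z 0.
  have /existsP[t ezt] : [exists t, e z t].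
    apply: contraNT z_nz => /existsPn no_nbr; apply/eqP/e_twin => t.
    by rewrite e0; apply/negbTE/no_nbr.
  exact: (pentagon_complete e_sym e_tri e_2K2 e_twin e01 e12 e23 e34 e40 ezt).
- by rewrite -/e e01 e12 e23 e34 e40.
- apply/and5P; split; [exact: chord e01 e12|exact: chord e12 e23|exact: chord e23 e34| |].
    exact: chord e34 e40.
  exact: chord e40 e01.
Qed.

(** * Identification of the two matrices *)

Lemma equivalent_of_signs (n : nat) (A B : 'M[int]_n) (r c r' c' : 'I_n -> bool)
    (x y : 'I_n -> 'I_n -> bool) (s t : 'I_n -> 'I_n) :
    injective s -> injective t ->
    (forall i j, A i j = (-1) ^+ r i * (-1) ^+ c j * (-1) ^+ x i j) ->
    (forall i j, B i j = (-1) ^+ y i j) ->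
    (forall i j, y i j = r' i (+) c' j (+) x (s i) (t j)) ->
  mx_equivalent A B.
Proof.
move=> s_inj t_inj AE BE yE.
exists erefl, erefl, (perm s_inj), (perm t_inj).
exists (fun i => r' i (+) r (s i)), (fun j => c' j (+) c (t j)).
apply/matrixP => i j; rewrite castmx_id !mxE !permE AE BE yE -!signr_addb; congr (_ ^+ _).
case: (r' i); case: (c' j); case: (r _); case: (c _); case: (x _ _) => //.
Qed.

(** Column 0 is empty and rows are even, so columns 1 and 2 determine a row. Four distinct rows thus
    realize all four pairs of bits, and [g] finds the row for each pair. *)
Lemma equivalent_H4 (A : 'M[int]_4) (r c : 'I_4 -> bool) (x : 'I_4 -> 'I_4 -> bool) :
    even_sign_pattern x -> (forall i, x i 0 = false) ->
    (forall i j, A i j = (-1) ^+ r i * (-1) ^+ c j * (-1) ^+ x i j) ->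
  mx_equivalent A H4.
Proof.
move=> ev xi0 AE; pose o k (kP : (k < 4)%N) := Ordinal kP : 'I_4.
have x3 a : x a (o 3 isT) = x a (o 1 isT) (+) x a (o 2 isT).
  have := parity_row ev a; rewrite /parity !big_ord_recl big_ord0 xi0 /=.
  set u := x a _; set v := x a _; set w := x a _.
  have -> : x a (o 1 isT) = u by congr x; apply: val_inj.
  have -> : x a (o 2 isT) = v by congr x; apply: val_inj.
  have -> : x a (o 3 isT) = w by congr x; apply: val_inj.
  by case: u; case: v; case: w.
have ordE (j : 'I_4) : [\/ j = 0, j = o 1 isT, j = o 2 isT | j = o 3 isT].
  by case: j => [[|[|[|[|//]]]] jP];
    [constructor 1|constructor 2|constructor 3|constructor 4]; apply: val_inj.
pose phi i := (x i (o 1 isT), x i (o 2 isT)).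
have phi_inj : injective phi.
  move=> a b [eq1 eq2]; apply: (rows_inj ev) => j.
  by case: (ordE j) => ->; rewrite ?xi0 ?x3 ?eq1 ?eq2.
have [g _ gK] : bijective phi.
  by apply: inj_card_bij phi_inj _; rewrite card_prod card_bool card_ord.
pose y (i j : 'I_4) := H4 i j == -1.
pose s i := g (y i (o 1 isT), y i (o 2 isT)).
have s1 i : x (s i) (o 1 isT) = y i (o 1 isT) by have [] := gK (y i (o 1 isT), y i (o 2 isT)).
have s2 i : x (s i) (o 2 isT) = y i (o 2 isT) by have [] := gK (y i (o 1 isT), y i (o 2 isT)).
have s_inj : injective s.
  move=> i k /(can_inj gK); rewrite /y !mxE.
  by case: (ordE i) => ->; case: (ordE k) => ->.
apply: (@equivalent_of_signs _ A H4 r c (fun=> false) (fun=> false) x y s id) => //.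
  by move=> i j; rewrite /y !mxE; case: (ordE i) => ->; case: (ordE j) => ->.
move=> i j /=; case: (ordE j) => ->; rewrite ?x3 ?xi0 ?s1 ?s2 // /y !mxE.
  by case: (ordE i) => ->.
by case: (ordE i) => ->.
Qed.

Definition is_pair (T : finType) (P : pred T) : Prop :=
  exists p q, p != q /\ forall j, P j = (j == p) || (j == q).

Lemma is_pairP (T : finType) (P : pred T) (d d' : T) :
  is_pair P -> P d -> P d' -> d != d' -> forall j, P j = (j == d) || (j == d').
Proof.
case=> p [q [pq PE]]; rewrite !PE => + + + j; rewrite PE.
by case/orP => /eqP-> /orP[]/eqP->; rewrite ?eqxx // orbC.
Qed.

(** An even intersection that contains a point contains two, hence both pairs. *)
Lemma pair_meet_even (n : nat) (P Q : 'I_n -> bool) (d : 'I_n) :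
  is_pair P -> is_pair Q -> parity (fun j => P j && Q j) = false -> P d -> Q d -> P =1 Q.
Proof.
move=> pairP pairQ parPQ Pd Qd.
have PQd : P d && Q d by rewrite Pd Qd.
have [d' /andP[Pd' Qd'] d'd] := even_exists_other parPQ PQd.
by move=> j; rewrite (is_pairP pairP Pd' Pd d'd) (is_pairP pairQ Qd' Qd d'd).
Qed.

(** An even, nonempty, proper part of six columns has 2 or 4 elements; in the latter case its
    complement is a pair. *)
Lemma pair_up_to_flip (P : 'I_6 -> bool) : parity P = false ->
  (exists j, P j) -> (exists j, ~~ P j) -> exists b, is_pair (fun j => P j (+) b).
Proof.
rewrite parity_card => even_P [j Pj] [k nPk].
have P_gt0 : (0 < #|P|)%N by apply/card_gt0P; exists j.
have Pc_gt0 : (0 < #|[predC P]|)%N by apply/card_gt0P; exists k.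
have cardE := cardC P; rewrite card_ord in cardE.
have pair (Q : 'I_6 -> bool) : #|Q| = 2%N -> is_pair Q.
  move=> Q2; have : #|[set j | Q j]| == 2%N by rewrite cardsE Q2.
  case/cards2P=> p [q [pq QE]]; exists p, q; split=> // l.
  by have /setP/(_ l) := QE; rewrite !inE.
have [P2|P4] : #|P| = 2%N \/ #|[predC P]| = 2%N.
  move: even_P P_gt0 Pc_gt0 cardE; move: #|P| #|[predC P]| => u v. lia.
  exists false; apply: pair; rewrite -[RHS]P2; apply: eq_card => l.
  by rewrite !unfold_in addbF.
exists true; apply: pair; rewrite -[RHS]P4; apply: eq_card => l.
by rewrite !unfold_in addbT.
Qed.

Lemma equivalent_H6 (A : 'M[int]_6) (r c : 'I_6 -> bool) (x : 'I_6 -> 'I_6 -> bool)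
    (c0 c1 c2 c3 c4 : 'I_6) (e := meet_parity x) :
    even_sign_pattern x -> (forall j, x 0 j = false) -> (forall i, x i 0 = false) ->
    (forall i j, A i j = (-1) ^+ r i * (-1) ^+ c j * (-1) ^+ x i j) ->
    uniq [:: 0; c0; c1; c2; c3; c4] ->
    [&& e c0 c1, e c1 c2, e c2 c3, e c3 c4 & e c4 c0] ->
    [&& ~~ e c0 c2, ~~ e c1 c3, ~~ e c2 c4, ~~ e c3 c0 & ~~ e c4 c1] ->
  mx_equivalent A H6.
Proof.
move=> ev x0j xi0 AE uniq_c /and5P[e01 e12 e23 e34 e40] /and5P[e02 e13 e24 e30 e41].
have [b bP] : exists b : 'I_6 -> bool, forall a, a != 0 -> is_pair (fun j => x a j (+) b a).
  apply: (@fin_all_exists _ (fun=> bool) (fun a b => a != 0 -> is_pair (fun j => x a j (+) b))) => a.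
  have [->|a0] := eqVneq a 0; first by exists false.
  have [||b bP] := @pair_up_to_flip (x a) (parity_row ev a); last by exists b.
    apply/existsP; apply: contraNT a0 => /existsPn xa; apply/eqP/(rows_inj ev) => j.
    by rewrite x0j; apply/negbTE.
  by exists 0; rewrite xi0.
pose Y a j := x a j (+) b a.
have Y_inj a a' : Y a =1 Y a' -> a = a'.
  move=> eqY; have := eqY 0; rewrite /Y !xi0 /= => eqb.
  by apply: (rows_inj ev) => j; have := eqY j; rewrite /Y eqb => /addIb.
(* Complementing rows changes the meet by the parity of rows and of the size, all even. *)
have meetY a a' : parity (fun j => Y a j && Y a' j) = e a a'.
  rewrite (@eq_parity _ _ (fun j => ((x a j && x a' j) (+) (b a' && x a j))
     (+) ((b a && x a' j) (+) (b a && b a' && true)))).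
    by rewrite !(parityD, parity_andl) !(parity_row ev) (parity_all ev) !andbF !addbF.
  by move=> j; rewrite /Y; case: (x a j); case: (x a' j); case: (b a); case: (b a').
have [nz0 nz1 nz2 nz3 nz4] : [/\ c0 != 0, c1 != 0, c2 != 0, c3 != 0 & c4 != 0].
  move: uniq_c; rewrite cons_uniq !inE !negb_or -!andbA ![0 == _]eq_sym.
  by case/and5P=> -> -> -> -> /andP[->].
have meet_point a a' : e a a' -> exists j, Y a j && Y a' j.
  by rewrite -meetY; apply: parity_exists.
have disjointY a a' : a != 0 -> a' != 0 -> a != a' -> ~~ e a a' -> forall j, Y a j -> ~~ Y a' j.
  move=> a0 a'0 aa'; rewrite -meetY => /negbTE meet0 j Yj; apply/negP => Y'j.
  by move/eqP: aa'; apply; apply/Y_inj/(pair_meet_even (bP a a0) (bP a' a'0) meet0 Yj Y'j).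
have [d0 /andP[Y00 Y10]] := meet_point _ _ e01.
have [d1 /andP[Y11 Y21]] := meet_point _ _ e12.
have [d2 /andP[Y22 Y32]] := meet_point _ _ e23.
have [d3 /andP[Y33 Y43]] := meet_point _ _ e34.
have [d4 /andP[Y44 Y04]] := meet_point _ _ e40.
(* Any two of the points [d0], ..., [d4] lie in pairs of nonadjacent rows, which are disjoint. *)
have neq a a' j j' : a != 0 -> a' != 0 -> a != a' -> ~~ e a a' -> Y a j -> Y a' j' -> j != j'.
  move=> a0 a'0 aa' eaa' Yj; apply: contraTneq => <-; exact: disjointY eaa' j Yj.
have uniq_cs := uniq_c; rewrite /= !inE !negb_or -!andbA in uniq_cs.
case/and5P: uniq_cs => n00 n01' n02' n03' /and5P[n04' k01 k02 k03 /and5P[k04 k12 k13 k14 /and4P[k23 k24 k34 _]]].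
have k30 : c3 != c0 by rewrite eq_sym.
have k41 : c4 != c1 by rewrite eq_sym.
have d01 : d0 != d1 := neq _ _ _ _ nz0 nz2 k02 e02 Y00 Y21.
have d02 : d0 != d2 := neq _ _ _ _ nz0 nz2 k02 e02 Y00 Y22.
have d03 : d0 != d3 := neq _ _ _ _ nz1 nz3 k13 e13 Y10 Y33.
have d04 : d0 != d4 by rewrite eq_sym; apply: neq nz4 nz1 k41 e41 Y44 Y10.
have d12 : d1 != d2 := neq _ _ _ _ nz1 nz3 k13 e13 Y11 Y32.
have d13 : d1 != d3 := neq _ _ _ _ nz1 nz3 k13 e13 Y11 Y33.
have d14 : d1 != d4 := neq _ _ _ _ nz2 nz4 k24 e24 Y21 Y44.
have d23 : d2 != d3 := neq _ _ _ _ nz2 nz4 k24 e24 Y22 Y43.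
have d24 : d2 != d4 := neq _ _ _ _ nz2 nz4 k24 e24 Y22 Y44.
have d34 : d3 != d4 := neq _ _ _ _ nz3 nz0 k30 e30 Y33 Y04.
have [d5 nd5] : exists d5, d5 \notin [:: d4; d0; d1; d2; d3].
  apply/existsP; apply: contraT => /existsPn all_d.
  have := card_size [:: d4; d0; d1; d2; d3].
  by rewrite (@eq_card _ _ 'I_6) ?card_ord // => j; have /negPn-> := all_d j.
pose s (i : 'I_6) := tnth [tuple 0; c0; c1; c2; c3; c4] i.
(* [d5] lies in none of the five pairs and goes to the positive first column of [H6]; [d4] and [d0],
   the pair of [c0], go to columns 1 and 2, the negative ones in row 1. *)
pose t (i : 'I_6) := tnth [tuple d5; d4; d0; d1; d2; d3] i.
have s_inj : injective s by apply/tuple_uniqP.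
have t_inj : injective t.
  apply/tuple_uniqP; rewrite /= nd5 !inE !negb_or d01 d02 d03 d12 d13 d23.
  by rewrite ![d4 == _]eq_sym d04 d14 d24 d34.
pose y (i j : 'I_6) := H6 i j == -1.
apply: (@equivalent_of_signs _ A H6 r c (fun i => if i == 0 then false else b (s i)) (fun=> false) x y s t) => //.
  move=> i j; rewrite /y !mxE.
  by case: i => [[|[|[|[|[|[|//]]]]]] iP]; case: j => [[|[|[|[|[|[|//]]]]]] jP].
have YE a d d' k k' : a != 0 -> Y a d -> Y a d' -> d = t k -> d' = t k' -> k != k' ->
    forall j, b a (+) x a (t j) = (j == k) || (j == k').
  move=> a0 Yd Yd' dk dk' kk' j; rewrite dk in Yd; rewrite dk' in Yd'.
  by rewrite addbC (is_pairP (bP a a0) Yd Yd') ?(inj_eq t_inj).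
pose o k (kP : (k < 6)%N) := Ordinal kP.
move=> i j; rewrite addbF; case: i => [[|[|[|[|[|[|//]]]]]] iP].
- rewrite (_ : s _ = 0) // x0j /y mxE.
  by case: j => [[|[|[|[|[|[|//]]]]]] jP].
- rewrite (YE c0 d4 d0 (o 1 isT) (o 2 isT)) // /y mxE.
  by case: j => [[|[|[|[|[|[|//]]]]]] jP].
- rewrite (YE c1 d0 d1 (o 2 isT) (o 3 isT)) // /y mxE.
  by case: j => [[|[|[|[|[|[|//]]]]]] jP].
- rewrite (YE c2 d1 d2 (o 3 isT) (o 4 isT)) // /y mxE.
  by case: j => [[|[|[|[|[|[|//]]]]]] jP].
- rewrite (YE c3 d2 d3 (o 4 isT) (o 5 isT)) // /y mxE.
  by case: j => [[|[|[|[|[|[|//]]]]]] jP].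
rewrite (YE c4 d3 d4 (o 5 isT) (o 1 isT)) // /y mxE.
by case: j => [[|[|[|[|[|[|//]]]]]] jP].
Qed.

Theorem corollary1p2 :
  (forall (n : nat) (H : 'M[int]_n), (0 < n)%N -> full_thick_te_interlace H ->
     (mx_equivalent H H4 \/ mx_equivalent H H6) /\
     ~ (mx_equivalent H H4 /\ mx_equivalent H H6)) /\
  (forall (n : nat) (H : 'M[int]_n), (8 <= n)%N -> ~ full_thick_te_interlace H).
Proof.
have classify (n : nat) (H : 'M[int]_n) : (0 < n)%N -> full_thick_te_interlace H ->
    mx_equivalent H H4 \/ mx_equivalent H H6.
  case: n H => // n H _ te.
  have [r [c [x [HE x0j xi0 tex]]]] := normalize_interlace te.
  have ev := normalized_even tex x0j xi0.
  have [n_le4|n_gt4] := leqP n.+1 4.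
    have n3 : n = 3%N by have := four_le ev; lia.
    by left; subst n; apply: equivalent_H4 ev xi0 HE.
  have [c0 [c1 [c2 [c3 [c4 [uniq_c all_c edges chords]]]]]] := interlace_pentagon n_gt4 tex ev x0j.
  have n5 : n = 5%N.
    apply: succn_inj; rewrite -[LHS]card_ord -[RHS](card_uniqP uniq_c).
    by apply: eq_card => z; rewrite all_c.
  by right; subst n; apply: equivalent_H6 ev x0j xi0 HE uniq_c edges chords.
split=> [n H n_gt0 te|n H n_ge8 te].
  split; first exact: classify.
  (* Equivalence includes equality of sizes, which separates 4 from 6. *)
  by case=> -[n4 _] [n6 _]; rewrite n4 in n6.
have [] := classify n H (ltn_trans _ n_ge8) te => // -[n_eq _]; by rewrite n_eq in n_ge8.
Qed.
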